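(* Let $n=p_1^{\alpha_1}\cdots p_k^{\alpha_k}$, where $k\geq 1$, $\alpha_i\geq 1$ and the $p_i$ are distinct primes satisfying $p_i\equiv 1\pmod 4$ for all $i=1,\ldots,k$. Then $\mathcal{K}_4(G_n)=0$ (that is, the Paley-type graph $G_n$ has no clique of order four) if and only if $p_i\in\{5,13,17\}$ for some $i\in\{1,\ldots,k\}$.
   Context: For $n=p_1^{\alpha_1}\cdots p_k^{\alpha_k}$ with distinct primes $p_i\equiv 1\pmod 4$ and $\alpha_i\ge 1$, let $\mathbb{Z}_n^\ast$ be the group of units of the ring $\mathbb{Z}_n=\mathbb{Z}/n\mathbb{Z}$. The Paley-type graph $G_n$ is the simple undirected graph with vertex set $\mathbb{Z}_n$ in which $xy$ is an edge if and only if $x-y\equiv a^2\pmod n$ for some $a\in\mathbb{Z}_n^\ast$ (this is symmetric since $-1$ is a square in $\mathbb{Z}_n^\ast$). For a graph $G$, $\mathcal{K}_m(G)$ denotes the number of cliques of order $m$ in $G$, i.e. the number of $m$-element sets of pairwise adjacent vertices. *)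

(* Defs.v *)
From HB Require Import structures.
From mathcomp Require Import all_boot all_order all_algebra.

Set Implicit Arguments.
Unset Strict Implicit.
Unset Printing Implicit Defensive.

Import GRing.Theory.

Definition is_clique (T : finType) (e : rel T) (A : {set T}) : bool :=
  [forall x in A, forall y in A, (x != y) ==> e x y].

Definition num_cliques (m : nat) (T : finType) (e : rel T) : nat :=
  #|[set A : {set T} | (#|A| == m) && is_clique e A]|.

(* ['Z_n] is the ring of integers modulo n only for n > 1. This relation is
   irreflexive, and it is symmetric when -1 is the square of a unit modulo n. *)
Definition paley_type (n : nat) : rel 'Z_n :=
  fun x y => [exists a : 'Z_n, (a \is a GRing.unit) && (x - y == a ^+ 2)%R].

(* Main.v *)
(* Cliques of the graph modulo n reduce to cliques modulo each prime divisor,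
   and the Paley graphs on 5, 13 and 17 vertices have no K4. Conversely, by the
   Chinese remainder theorem it suffices to find a K4 modulo each prime power
   q = p^e with p > 17. The unit group modulo q is cyclic, so "being a square"
   is a multiplicative character chi on the integers prime to p, and
   chi(-1) = 1 as 4 divides p - 1. Since R(4,4) = 18, the colouring chi(i - j)
   of the pairs from 0, ..., 17 has a monochromatic K4. Scaling it by one of
   its differences makes all of its differences squares. *)

Require Import Defs.
From HB Require Import structures.
From mathcomp Require Import all_boot all_order all_algebra.
From mathcomp Require Import all_fingroup all_solvable.

Set Implicit Arguments.
Unset Strict Implicit.
Unset Printing Implicit Defensive.

Import GRing.Theory.

(** * Cyclic groups of units and their squares *)

(** The unit group modulo [q] is isomorphic to the automorphism group of the additive cyclic
    [p]-group of order [q], whose structure is known. *)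
Lemma units_Zp_pfactor_cyclic p e : prime p -> odd p -> 0 < e ->
  cyclic (units_Zp (p ^ e)).
Proof.
move=> p_pr p_odd e_gt0; set q := p ^ e.
have q_gt1 : 1 < q by rewrite -(exp1n e) ltn_exp2r // prime_gt1.
have oZ : #[Zp1 : 'Z_q]%g = q by rewrite order_Zp1 Zp_cast.
have := isog_cyclic (Zp_unit_isog (Zp1 : 'Z_q)); rewrite oZ => ->.
have pZ : (p.-group <[Zp1 : 'Z_q]>)%g by rewrite /pgroup -orderE oZ pnatX pnat_id.
have ntZ : <[Zp1 : 'Z_q]>%g :!=: 1%g by rewrite cycle_eq1 -order_gt1 oZ.
have [m [_ [_ cycF _ _]]] :=
  cyclic_pgroup_Aut_structure pZ (cycle_cyclic _) ntZ.
(* In the first case, order [p], the automorphism group equals its cyclic [p']-part. In the second,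
   oddness of [p] selects the cyclic branch. *)
case: ifP => _; first by move=> defA; move: cycF; rewrite -[X in cyclic X]defA.
by case=> t [_ _ _]; rewrite p_odd => -[[]].
Qed.

Section CyclicSquares.

Local Open Scope group_scope.
Variables (gT : finGroupType) (G : {group gT}).
Hypothesis cycG : cyclic G.
Let sqG := [set x ^+ 2 | x in G].

(** Squares form a subgroup, which settles all cases but two nonsquares. Those are odd powers of a
    generator, so their product is an even power. *)
Lemma cyclic_mem_sqrM : {in G &, forall x y,
  (x * y \in sqG) = ((x \in sqG) == (y \in sqG))}.
Proof.
have cG := centsP (cyclic_abelian cycG).
have sqM x y : x \in sqG -> y \in sqG -> x * y \in sqG.
  case/imsetP=> a aG -> /imsetP[b bG ->].
  by apply/imsetP; exists (a * b); rewrite ?groupM ?expgMn //; apply: cG.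
have sqV x : x \in sqG -> x^-1 \in sqG.
  case/imsetP=> a aG ->.
  by apply/imsetP; exists a^-1; rewrite ?groupV ?expVgn.
have nsq g i : G :=: <[g]> -> g ^+ i \notin sqG -> odd i.
  move=> defG; apply: contraR => i_even; apply/imsetP; exists (g ^+ i./2).
    by rewrite defG mem_cycle.
  by rewrite -expgM muln2 even_halfK.
move=> x y xG yG.
case sx: (x \in sqG); case sy: (y \in sqG) => //=.
- by rewrite sqM.
- by apply: contraFF sy => /(sqM _ _ (sqV _ sx)); rewrite mulKg.
- by apply: contraFF sx => /sqM /(_ (sqV _ sy)); rewrite mulgK.
case/cyclicP: (cycG) => g defG; move: xG yG sx sy; rewrite defG.
case/cycleP=> i -> /cycleP[j ->] /negbT/(nsq _ _ defG) oi /negbT/(nsq _ _ defG) oj.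
rewrite -expgD; apply/imsetP; exists (g ^+ (i + j)./2).
  by rewrite defG mem_cycle.
by rewrite -expgM muln2 even_halfK // oddD oi oj.
Qed.

(** If [x] is [g ^+ i] for a generator [g], then 4 divides [i * 2], so [i] is even. This is meant
    for -1 in the unit group. *)
Lemma cyclic_involution_sqr x :
  4 %| #|G| -> x \in G -> x ^+ 2 = 1 -> x \in sqG.
Proof.
case/cyclicP: (cycG) => g defG; rewrite defG -orderE => g4 /cycleP[i ->] /eqP.
rewrite -expgM -order_dvdn => /(dvdn_trans g4); rewrite (@dvdn_pmul2r 2 2) //.
move=> /dvdnP[j ->]; apply/imsetP; exists (g ^+ j); rewrite ?expgM //.
by rewrite defG mem_cycle.
Qed.

End CyclicSquares.

(** * Edges and cliques on natural-number representatives *)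

(* On natural-number representatives, and also meaningful for [n = 1], unlike
   [paley_type], since ['Z_1] is Z/2Z. *)
Definition qedge (n x y : nat) : bool :=
  has (fun a => coprime a n && (x == y + a ^ 2 %[mod n])) (iota 0 n).

Lemma qedgeP n x y : 0 < n ->
  reflect (exists2 a, coprime a n & x = y + a ^ 2 %[mod n]) (qedge n x y).
Proof.
move=> n_gt0; apply: (iffP hasP) => [[a _ /andP[? /eqP]]|[a co xy]].
  by exists a.
exists (a %% n); first by rewrite mem_iota ltn_mod.
by rewrite coprime_modl co -modnDmr modnXm modnDmr xy /=.
Qed.

Lemma qedge_paley n x y : 1 < n ->
  qedge n x y = @paley_type n x%:R%R y%:R%R.
Proof.
move=> n_gt1; have n_gt0 := ltnW n_gt1.
apply/(qedgeP _ _ n_gt0)/existsP => [[a co e]|[a /andP[ua /eqP e]]].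
- exists (a%:R : 'Z_n)%R; rewrite unitZpE // coprime_sym co subr_eq -natrX -natrD.
  by rewrite addnC -(Zp_nat_mod _ x) // e Zp_nat_mod ?eqxx.
- exists (nat_of_ord a); first by rewrite coprime_sym -unitZpE // natr_Zp.
  by rewrite -!val_Zp_nat // natrD natrX natr_Zp -e addrC subrK.
Qed.

Lemma qedge_dvd m n x y : 0 < n -> m %| n -> qedge n x y -> qedge m x y.
Proof.
move=> n_gt0 mn /(qedgeP _ _ n_gt0)[a co /eqP e].
apply/qedgeP; first exact: dvdn_gt0 mn.
exists a; first exact: coprime_dvdr co.
by apply/eqP; rewrite -(modn_dvdm x mn) (eqP e) modn_dvdm.
Qed.

(** For [n > 1] irreflexivity forces the residues of the [f i] to be distinct. For [n = 1] every
    family qualifies, which starts the induction over a product of moduli. *)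
Definition has_qclique (m n : nat) : Prop :=
  exists f : nat -> nat,
    forall i j, i < m -> j < m -> i != j -> qedge n (f i) (f j).

Lemma has_qclique_dvd m d n : 0 < n -> d %| n -> has_qclique m n -> has_qclique m d.
Proof.
move=> n_gt0 dn [f cf]; exists f => i j im jm ij.
exact: qedge_dvd n_gt0 dn (cf i j im jm ij).
Qed.

(** The Chinese remainder theorem glues the vertices, and also the square roots of their
    differences. *)
Lemma has_qcliqueM m n1 n2 : 0 < n1 -> 0 < n2 -> coprime n1 n2 ->
  has_qclique m n1 -> has_qclique m n2 -> has_qclique m (n1 * n2).
Proof.
move=> n1_gt0 n2_gt0 co [f cf] [g cg].
exists (fun i => chinese n1 n2 (f i) (g i)) => i j im jm ij.
have /qedgeP[//|a coa fij] := cf i j im jm ij.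
have /qedgeP[//|b cob gij] := cg i j im jm ij.
apply/qedgeP; first by rewrite muln_gt0 n1_gt0.
exists (chinese n1 n2 a b).
  rewrite coprimeMr -coprime_modl chinese_modl // coprime_modl coa.
  by rewrite -coprime_modl chinese_modr // coprime_modl cob.
apply/eqP; rewrite chinese_remainder //; apply/andP; split; apply/eqP.
  rewrite chinese_modl // fij -[RHS]modnDm -[in RHS]modnXm !chinese_modl //.
  by rewrite modnXm modnDm.
rewrite chinese_modr // gij -[RHS]modnDm -[in RHS]modnXm !chinese_modr //.
by rewrite modnXm modnDm.
Qed.

Lemma has_qclique_prod m (I : eqType) (r : seq I) (F : I -> nat) :
  uniq r -> (forall i, 0 < F i) ->
  {in r &, forall i j, i != j -> coprime (F i) (F j)} ->
  {in r, forall i, has_qclique m (F i)} ->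
  has_qclique m (\prod_(i <- r) F i).
Proof.
move=> + F_gt0; elim: r => [|i r IHr] /=.
  by move=> *; exists id => i j _ _ _; rewrite big_nil /qedge /= !modn1.
case/andP=> ir r_uniq coF cliqueF; rewrite big_cons.
apply: has_qcliqueM => //.
- by rewrite prodn_gt0.
- rewrite big_seq coprime_sym; apply: (big_ind (fun x => coprime x (F i))).
  + exact: coprime1n.
  + by move=> x y cox coy; rewrite coprimeMl cox.
  move=> j jr; apply: coF; rewrite ?inE ?eqxx ?jr ?orbT //.
  by apply: contraNneq ir => <-.
- by apply: cliqueF; rewrite mem_head.
apply: IHr => // [j l jr lr|j jr].
  by apply: coF; rewrite inE ?jr ?lr orbT.
by apply: cliqueF; rewrite inE jr orbT.
Qed.

(** A clique is enumerated to give [f]. Conversely, irreflexivity makes [f] injective, so its image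
    has exactly [m] elements. *)
Lemma num_cliques_neq0P m (T : finType) (e : rel T) :
  irreflexive e ->
  reflect (exists f : 'I_m -> T, forall i j : 'I_m, i != j -> e (f i) (f j))
          (num_cliques m e != 0).
Proof.
move=> e_irr; rewrite /num_cliques cards_eq0; apply: (iffP (set0Pn _)).
  case=> A; rewrite inE => /andP[/eqP Am /forall_inP cA].
  exists (fun i => enum_val (cast_ord (esym Am) i)) => i j ij.
  have /forall_inP/(_ _ (enum_valP (cast_ord (esym Am) j)))/implyP :=
    cA _ (enum_valP (cast_ord (esym Am) i)).
  by apply; rewrite (inj_eq enum_val_inj) (inj_eq (@cast_ord_inj _ _ _)).
case=> f cf; exists [set f i | i in 'I_m]; rewrite inE card_imset ?card_ord ?eqxx /=.
  apply/forall_inP => _ /imsetP[i _ ->]; apply/forall_inP => _ /imsetP[j _ ->].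
  by apply/implyP => fij; apply: cf; apply: contraNneq fij => ->.
move=> i j eq_f; apply/eqP; apply: contraT => /cf.
by rewrite eq_f e_irr.
Qed.

Lemma paley_type_irr n : 1 < n -> irreflexive (@paley_type n).
Proof.
move=> n_gt1 x; apply/existsP => -[a /andP[ua]]; rewrite subrr eq_sym => /eqP a0.
by have := unitrX 2 ua; rewrite a0 unitr0.
Qed.

Lemma num_cliques_paley n m : 1 < n ->
  num_cliques m (@paley_type n) != 0 <-> has_qclique m n.
Proof.
move=> n_gt1; split=> [/(num_cliques_neq0P _ (paley_type_irr n_gt1))[f cf]|[f cf]].
  (* [inord] needs a nonempty ordinal type, hence the separate case [m = 0]. *)
  case: m f cf => [|m] f cf; first by exists id.
  exists (fun i => nat_of_ord (f (inord i))) => i j im jm ij.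
  rewrite qedge_paley // !natr_Zp; apply: cf.
  by apply: contraNneq ij => /(congr1 (@nat_of_ord _)); rewrite !inordK // => ->.
apply/(num_cliques_neq0P _ (paley_type_irr n_gt1)).
exists (fun i : 'I_m => (f i)%:R%R : 'Z_n) => i j ij.
by rewrite -qedge_paley // cf.
Qed.

Lemma qedgeDl n x d : qedge n (x + d) x = qedge n d 0.
Proof. by apply: eq_has => a; rewrite eqn_modDl add0n. Qed.

Lemma qedge_mod n x y : qedge n (x %% n) (y %% n) = qedge n x y.
Proof. by apply: eq_has => a; rewrite modn_mod modnDml. Qed.


(** * Small moduli: no K4 for 5, 13 and 17 *)

(** Each level keeps only the common neighbours of the vertices chosen so far, which keeps the
    exhaustive search small. *)
Definition K4_free_mod (n : nat) : bool :=
  all (fun w => let s := [seq x <- iota 0 n | qedge n x w] in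
    all (fun x => let t := [seq y <- s | qedge n y x] in
      all (fun y => nilp [seq z <- t | qedge n z y]) t) s) (iota 0 n).

Lemma K4_free_modP n : 0 < n -> K4_free_mod n -> ~ has_qclique 4 n.
Proof.
move=> n_gt0 free [f cf].
have fI i : f i %% n \in iota 0 n by rewrite mem_iota ltn_mod.
have fE i j : i < 4 -> j < 4 -> i != j -> qedge n (f i %% n) (f j %% n).
  by move=> *; rewrite qedge_mod cf.
move/allP/(_ _ (fI 0))/allP: free => /(_ (f 1 %% n)).
rewrite mem_filter fE // fI => /(_ isT)/allP/(_ (f 2 %% n)).
rewrite !mem_filter !fE // fI => /(_ isT)/nilP/eqP; apply/negP.
by rewrite -has_filter; apply/hasP; exists (f 3 %% n); rewrite ?mem_filter ?fI !fE.
Qed.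

Lemma K4_free_mod_5_13_17 : all K4_free_mod [:: 5; 13; 17].
Proof. by vm_compute. Qed.

(** * Large primes: a K4 modulo every prime power *)

(* An instance of R(4,4) <= 18: multiplicativity leaves only the 2^7 choices of
   [c] on the primes up to 17, which are checked exhaustively. *)
Lemma mono_K4_multiplicative (c : nat -> bool) :
    (forall x y, 0 < x -> 0 < y -> x * y <= 17 -> c (x * y) = (c x == c y)) ->
  exists a b d, [/\ 0 < a < b, b < d <= 17 &
    {in [:: b; d; b - a; d - a; d - b], forall e, c e = c a}].
Proof.
move=> cM.
(* The colours of 1 to 17 in terms of those of the primes; squares get [true], and the entry at 0 is
   a filler. *)
pose tbl := [:: true; true; c 2; c 3; true; c 5; c 2 == c 3; c 7; c 2; true;
  c 2 == c 5; c 11; c 3; c 13; c 2 == c 7; c 3 == c 5; true; c 17].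
have c1 : c 1 = true by rewrite (cM 1 1) // eqxx.
have c4 : c 4 = true by rewrite (cM 2 2) // eqxx.
have cE e : 0 < e <= 17 -> c e = nth true tbl e.
  do 18?[case: e => [|e]] => //= _.
  - by rewrite (cM 2 3).
  - by rewrite (cM 2 4) // c4 eqb_id.
  - by rewrite (cM 3 3) // eqxx.
  - by rewrite (cM 2 5).
  - by rewrite (cM 3 4) // c4 eqb_id.
  - by rewrite (cM 2 7).
  - by rewrite (cM 3 5).
  - by rewrite (cM 4 4) // eqxx.
(* The K4 is translated so that its vertices are 0, [a], [b] and [d]; its six differences are [a]
   and the five listed. *)
pose mono t a b d :=
  all (fun e => nth true t e == nth true t a) [:: b; d; b - a; d - a; d - b].
have : has (fun d => has (fun b => has (fun a => mono tbl a b d)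
    (iota 1 b.-1)) (iota 1 d.-1)) (iota 1 17).
  rewrite /tbl.
  by case: (c 2); case: (c 3); case: (c 5); case: (c 7); case: (c 11);
     case: (c 13); case: (c 17); vm_compute.
case/hasP=> d; rewrite mem_iota => /andP[d0 d17] /hasP[b].
rewrite mem_iota add1n prednK // => /andP[b0 bd] /hasP[a].
rewrite mem_iota add1n prednK // => /andP[a0 ab] /allP m.
have b17 := ltn_trans bd d17; have ad := ltn_trans ab bd.
exists a, b, d; split=> [||e e_in]; rewrite ?a0 ?bd //.
have /allP bnd : all (fun e => 0 < e <= 17) [:: a; b; d; b - a; d - a; d - b].
  rewrite /= !subn_gt0 ab ad bd a0 b0 d0 /= !(leq_trans (leq_subr _ _)) //.
  by rewrite -ltnS (ltn_trans ab) // -ltnS b17 -ltnS d17.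
by rewrite (cE e) ?(cE a) ?bnd ?(eqP (m e e_in)) // inE ?eqxx ?e_in ?orbT.
Qed.

Lemma pfactor_has_qclique4 p e :
  prime p -> p = 1 %[mod 4] -> 17 < p -> 0 < e -> has_qclique 4 (p ^ e).
Proof.
move=> p_pr p14 p17 e_gt0; set q := p ^ e.
have p_odd : odd p.
  by have := modn_dvdm p (isT : 2 %| 4); rewrite p14 !modn2; case: (odd p).
have q_gt1 : 1 < q by rewrite -(exp1n e) ltn_exp2r // prime_gt1.
have q_gt0 := ltnW q_gt1.
have cycU := units_Zp_pfactor_cyclic p_pr p_odd e_gt0.
have card4 : 4 %| #|units_Zp q|.
  rewrite card_units_Zp // totient_pfactor // dvdn_mulr //.
  by rewrite -subn1 -eqn_mod_dvd ?prime_gt0 // p14.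
pose S := [set x ^+ 2 | x in units_Zp q]%g.
have unitS (u : {unit 'Z_q}) d : val u = d%:R%R -> qedge q d 0 = (u \in S).
  move=> ud; rewrite qedge_paley // -ud; apply/existsP/imsetP.
    case=> a [/andP[ua /eqP ea]]; exists (FinRing.unit 'Z_q ua); rewrite ?inE //.
    by apply: val_inj; rewrite /= -[LHS]subr0.
  case=> v _ ->; exists (val v); rewrite subr0; apply/andP; split=> //.
  exact: valP.
(* All differences that occur are at most 17, hence below [p] and invertible modulo [q]. *)
have mk d : 0 < d <= 17 -> {u : {unit 'Z_q} | val u = d%:R%R}.
  case/andP=> d0 d17; have ud : (d%:R%R : 'Z_q) \is a GRing.unit.
    rewrite unitZpE // coprimeXl // prime_coprime // gtnNdvd //.
    exact: leq_ltn_trans p17.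
  by exists (FinRing.unit 'Z_q ud).
have cM x y : 0 < x <= 17 -> 0 < y <= 17 ->
    qedge q (x * y) 0 = (qedge q x 0 == qedge q y 0).
  move=> /mk[u ux] /mk[v vy].
  rewrite (unitS u x) // (unitS v y) // (unitS (u * v)%g).
    by rewrite (cyclic_mem_sqrM cycU) ?inE.
  by rewrite /= ux vy natrM.
have sym x y : qedge q x y -> qedge q y x.
  (* Since -1 squares to 1 and 4 divides the order of the unit group, -1 is a square, so edges can
     be reversed. *)
  have u1 : (-1 : 'Z_q)%R \is a GRing.unit by rewrite unitrN1.
  have : FinRing.unit 'Z_q u1 \in S.
    apply: cyclic_involution_sqr; rewrite ?inE //.
    by apply: val_inj; rewrite /= mulrNN mul1r.
  case/imsetP=> i _ /(congr1 val)/= i2.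
  rewrite !qedge_paley // => /existsP[a /andP[ua /eqP ea]].
  apply/existsP; exists (a * val i)%R; rewrite unitrM ua (valP i) /=.
  by rewrite exprMn -ea expr2 -i2 mulrN1 opprB.
have [|a [b [d [/andP[a0 ab] /andP[bd d17] m]]]] := @mono_K4_multiplicative (qedge q ^~ 0).
  move=> x y x0 y0 xy; apply: cM; rewrite ?x0 ?y0 /=.
    by apply: leq_trans xy; rewrite leq_pmulr.
  by apply: leq_trans xy; rewrite leq_pmull.
have ad := ltn_trans ab bd; have b17 := leq_trans (ltnW bd) d17.
have a17 := leq_trans (ltnW ab) b17.
pose g := nth 0 [:: 0; a; b; d].
have gE i j : i < j < 4 ->
    [/\ g i <= g j, 0 < g j - g i <= 17 & qedge q (g j - g i) 0 = qedge q a 0].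
  case: i j => [|[|[|i]]] [|[|[|[|j]]]]; rewrite ?andbF //= => _; rewrite /g /= ?subn0 ?subn_gt0.
  - by rewrite a0.
  - by rewrite (ltn_trans a0) // m // !inE eqxx.
  - by rewrite (ltn_trans a0) // m // !inE eqxx orbT.
  - by rewrite ab ltnW // m ?(leq_trans (leq_subr _ _)) // !inE eqxx !orbT.
  - by rewrite ad ltnW // m ?(leq_trans (leq_subr _ _)) // !inE eqxx !orbT.
  - by rewrite bd ltnW // m ?(leq_trans (leq_subr _ _)) // !inE eqxx !orbT.
(* All differences of [g] have the same character value as [a], so multiplying them by [a] gives
   squares. *)
have edge x y : x < y < 4 -> qedge q (a * g y) (a * g x).
  move=> /gE[gij gij17 eq_chi].
  by rewrite -(subnKC gij) mulnDr qedgeDl cM ?eq_chi // a0 a17.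
exists (fun i => a * g i) => i j i4 j4.
by rewrite neq_ltn => /orP[ij|ij]; [apply: sym|]; apply: edge; rewrite ij.
Qed.

Theorem corollary1p7 (k : nat) (p alpha : 'I_k -> nat) (n : nat)
    (k_ge1 : 1 <= k)
    (alpha_ge1 : forall i : 'I_k, 1 <= alpha i)
    (p_prime : forall i : 'I_k, prime (p i))
    (p_distinct : injective p)
    (p_mod4 : forall i : 'I_k, p i = 1 %[mod 4])
    (n_def : n = \prod_(i < k) p i ^ alpha i) :
  num_cliques 4 (@paley_type n) = 0 <->
  exists i : 'I_k, p i \in [:: 5; 13; 17].
Proof.
have F_gt0 i : 0 < p i ^ alpha i by rewrite expn_gt0 prime_gt0.
have n_gt0 : 0 < n by rewrite n_def prodn_gt0.
have p_dvd i : p i %| n.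
  by rewrite n_def (bigD1 i) //= dvdn_mulr // dvdn_exp.
have n_gt1 : 1 < n.
  exact: leq_trans (prime_gt1 (p_prime (Ordinal k_ge1))) (dvdn_leq n_gt0 (p_dvd _)).
have cliqueP := num_cliques_paley 4 n_gt1.
split=> [clique0|[i pi_small]]; last first.
  apply/eqP; apply: contraT => /cliqueP /(has_qclique_dvd n_gt0 (p_dvd i)) clq.
  case: (K4_free_modP (prime_gt0 (p_prime i)) _ clq).
  exact: (allP K4_free_mod_5_13_17 _ pi_small).
apply/existsP; apply: contraT => /existsPn no_small.
suff /cliqueP : has_qclique 4 n by rewrite clique0.
rewrite n_def; apply: has_qclique_prod => // [|i j _ _ ij|i _].
- exact: index_enum_uniq.
- by rewrite coprimeXl ?coprimeXr // prime_coprime // dvdn_prime2 // (inj_eq p_distinct).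
apply: pfactor_has_qclique4 => //; rewrite ltnNge; apply: contra (no_small i).
(* 5, 13 and 17 are the only primes up to 17 congruent to 1 modulo 4, so any other [p i] exceeds
   17. *)
have /allP small : all (fun x => prime x && (x == 1 %[mod 4]) ==>
    (x \in [:: 5; 13; 17])) (iota 0 18) by vm_compute.
rewrite -ltnS => pi17; have := small (p i).
by rewrite mem_iota pi17 p_prime p_mod4 eqxx => /(_ isT).
Qed.
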